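(* Let $f\in C^1(\mathbb{R}^d,\mathbb{R})$ and assume: (A1) there is $L\ge0$ with $\|\nabla f(x)-\nabla f(y)\|\le L\|x-y\|$ for all $x,y\in\mathbb{R}^d$; (A2 and F2) $f$ has a minimizer $x^\star\in\arg\min_{\mathbb{R}^d}f$, and there are a Polish probability space $(\mathsf Z,\mathcal Z,\pi^Z)$ and $\eta\ge0$ such that one of the following holds: (a) there is $H:\mathbb{R}^d\times\mathsf Z\to\mathbb{R}^d$ such that for all $x$, $\int H(x,z)d\pi^Z(z)=\nabla f(x)$ and $\int\|H(x,z)-\nabla f(x)\|^2d\pi^Z(z)\le\eta$; and $f$ is convex; (b) there is $\tilde f:\mathbb{R}^d\times\mathsf Z\to\mathbb{R}$ such that for all $z$, $\tilde f(\cdot,z)$ is $C^1$ with $L$-Lipschitz gradient, $\int\tilde f(x,z)d\pi^Z(z)=f(x)$ and $\int\nabla\tilde f(x,z)d\pi^Z(z)=\nabla f(x)$ for all $x$, and there is a point $\bar x\in\mathbb{R}^d$ with $\int\|\nabla\tilde f(\bar x,z)\|^2d\pi^Z(z)\le\eta$ (set $H=\nabla\tilde f$); and for all $z\in\mathsf Z$, $\tilde f(\cdot,z)$ is convex. Let $\gamma,\alpha\in(0,1)$, let $(Z_n)_{n\in\mathbb{N}}$ be independent random variables with law $\pi^Z$, and let $(X_n)_{n\in\mathbb{N}}$ start from $X_0\in\mathbb{R}^d$ and satisfy $X_{n+1}=X_n-\gamma(n+1)^{-\alpha}H(X_n,Z_{n+1})$ for all $n\in\mathbb{N}$. Then there exists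 $C\ge0$ such that for any $N\ge1$, $$\mathbb{E}[f(X_N)]-\min_{\mathbb{R}^d}f\le C\,\frac{(1+\log(N+1))^2}{(N+1)^{\alpha\wedge(1-\alpha)}}.$$
   Context: $\nabla\tilde f$ denotes the gradient in the first variable. $a\wedge b=\min(a,b)$. All functions are assumed measurable. *)

(* Defs.v *)
From HB Require Import structures.
From mathcomp Require Import all_boot all_order all_algebra.
From mathcomp Require Import all_classical all_reals all_analysis.

Set Implicit Arguments.
Unset Strict Implicit.
Unset Printing Implicit Defensive.

Import Order.TTheory GRing.Theory Num.Theory.
Import numFieldNormedType.Exports.

Local Open Scope classical_set_scope.
Local Open Scope ring_scope.

Notation borel T := (g_sigma_algebraType (@open T)).

Definition separable (T : topologicalType) : Prop :=
  exists2 D : set T, countable D & dense D.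

Definition complete_metric (R : realType) (M : metricType R) : Prop :=
  forall F : set_system M, ProperFilter F -> cauchy F -> exists l : M, F --> l.

Definition completely_metrizable (R : realType) (T : topologicalType) : Prop :=
  exists (M : metricType R) (h : T -> M) (g : M -> T),
    [/\ complete_metric M, cancel h g, cancel g h, continuous h & continuous g].

Definition polish (R : realType) (T : topologicalType) : Prop :=
  separable T /\ completely_metrizable R T.

(* The library norm on 'rV[R]_d is the sup norm, hence this definition; both
   norms induce the same topology, so that [differentiable], [continuous] and
   the Borel sets are the usual ones. *)
Definition enorm (R : realType) (d : nat) (x : 'rV[R]_d) : R :=
  Num.sqrt (\sum_(i < d) x 0 i ^+ 2).

Definition grad (R : realType) (d : nat) (f : 'rV[R]_d -> R) (x : 'rV[R]_d) :
    'rV[R]_d :=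
  \row_(i < d) 'D_(delta_mx 0 i) f x.

Definition C1 (R : realType) (d : nat) (f : 'rV[R]_d -> R) : Prop :=
  (forall x, differentiable f x) /\ continuous (grad f).

Definition lipschitz_grad (R : realType) (d : nat) (L : R)
    (f : 'rV[R]_d -> R) : Prop :=
  forall x y, enorm (grad f x - grad f y) <= L * enorm (x - y).

Definition convex_fun (R : realType) (d : nat) (f : 'rV[R]_d -> R) : Prop :=
  @convex_function R 'rV[R]_d [set: 'rV[R]_d] f.

(* Integrability is part of the equality, since the library integral is
   total. *)
Definition has_integral (dT : measure_display) (T : measurableType dT)
    (R : realType) (mu : probability T R) (h : T -> R) (v : R) : Prop :=
  mu.-integrable [set: T] (EFin \o h) /\ (\int[mu]_z (h z)%:E = v%:E)%E.

Definition has_vintegral (dT : measure_display) (T : measurableType dT)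
    (R : realType) (mu : probability T R) (d : nat) (h : T -> 'rV[R]_d)
    (v : 'rV[R]_d) : Prop :=
  forall i : 'I_d, has_integral mu (fun z => h z 0 i) (v 0 i).

Definition jointly_measurable (R : realType) (d : nat) (Z : ptopologicalType)
    (dT : measure_display) (T : measurableType dT)
    (h : 'rV[R]_d -> Z -> T) : Prop :=
  measurable_fun [set: borel 'rV[R]_d * borel Z]
    (fun p : borel 'rV[R]_d * borel Z => h p.1 p.2).

Definition unbiased_bounded_variance (R : realType) (d : nat)
    (f : 'rV[R]_d -> R) (Z : ptopologicalType) (piZ : probability (borel Z) R)
    (eta : R) (H : 'rV[R]_d -> Z -> 'rV[R]_d) : Prop :=
  forall x,
    has_vintegral piZ (H x) (grad f x) /\
    (\int[piZ]_z (enorm (H x z - grad f x) ^+ 2)%:E <= eta%:E)%E.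

Definition gradient_of_random_functions (R : realType) (d : nat) (L : R)
    (f : 'rV[R]_d -> R) (Z : ptopologicalType) (piZ : probability (borel Z) R)
    (eta : R) (ft : 'rV[R]_d -> Z -> R) : Prop :=
  [/\ jointly_measurable ft,
      forall z, C1 (ft ^~ z) /\ lipschitz_grad L (ft ^~ z),
      forall x, has_integral piZ (ft x) (f x),
      forall x, has_vintegral piZ (fun z => grad (ft ^~ z) x) (grad f x) &
      exists xbar : 'rV[R]_d,
        (\int[piZ]_z (enorm (grad (ft ^~ z) xbar) ^+ 2)%:E <= eta%:E)%E].

Definition mutually_independent (dO dT : measure_display)
    (Omega : measurableType dO) (T : measurableType dT) (R : realType)
    (P : probability Omega R) (Y : nat -> Omega -> T) : Prop :=
  forall (J : seq nat) (A : nat -> set T), uniq J ->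
    (forall j, measurable (A j)) ->
    P (\big[setI/setT]_(j <- J) (Y j @^-1` A j)) =
      (\prod_(j <- J) P (Y j @^-1` A j))%E.

(* Main.v *)
Require Import Defs.
From HB Require Import structures.
From mathcomp Require Import all_boot all_order all_algebra.
From mathcomp Require Import all_classical all_reals all_analysis.
From mathcomp Require Import measurable_realfun ring lra zify.

Set Implicit Arguments.
Unset Strict Implicit.
Unset Printing Implicit Defensive.

Import Order.TTheory GRing.Theory Num.Theory.
Import numFieldNormedType.Exports.

Local Open Scope classical_set_scope.
Local Open Scope ring_scope.

(** Let xstar be the minimizer, c_n the step size gamma (n + 1)^(- alpha), and
    a_n the mean gap E[f(X_n)] - f(xstar).

    The two cases on H have a common consequence: E|H(x, Z)|^2 is at most
    A (f x - f xstar) + B for all x ([second_moment_variance] and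
    [second_moment_random_functions]).  It comes from cocoercivity of the
    gradient of a convex function with Lipschitz gradient ([cocoercive]): such a
    gradient is small, in square, where the function is nearly minimal.

    Since Z_{n+1} is independent of X_0, ..., X_n, expanding |X_{n+1} - Y|^2 for
    a comparison point Y that depends only on the past and using the gradient
    inequality of f gives ([mean_sqdist_step])

      E|X_{n+1} - Y|^2 + 2 c_n a_n
        <= E|X_n - Y|^2 + 2 c_n E[f(Y) - f xstar] + c_n^2 (A a_n + B).

    All terms are nonnegative extended reals, so that expectations can be taken
    first; finiteness of all of them then follows by induction on n.

    The choice Y = xstar controls weighted averages of the a_n, and the choice
    Y = X_m compares the average of a_m, ..., a_N with its first term a_m.
    Following Shamir and Zhang, let S_k be the average of a_{N-k}, ..., a_N with
    weights w_n = 2 c_n - A c_n^2.  The choice Y = X_{N-k} shows that a_{N-k} is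
    not much smaller than S_k, so that dropping it from the average increases
    the average only by a relative error A r_k and an absolute error B r_k, with
    r_k at most 16 c_N / k ([suffix_average_step]).  Descending from k = N/2 to
    k = 0 costs harmonic sums: c_N log N is bounded, so the product of the
    relative errors is bounded, and a_N = S_0 is at most a constant times
    S_{N/2} + c_N (1 + log N).  Restricting to the last half of the iterates
    makes all the steps in play comparable to c_N ([step_half]).

    Finally S_{N/2} is bounded by the choice Y = xstar: the sum of the c_n^2 is
    at most of order N^max(1 - 2 alpha, 0) log N, the total weight is at least
    of order N^(1 - alpha), and the exponent max(1 - 2 alpha, 0) - (1 - alpha) is
    - min(alpha, 1 - alpha) ([last_iterate_rate]). *)

(** * Convex functions with Lipschitz gradient *)

Section euclidean.
Context (R : realType) (d : nat).
Implicit Types (u v w x y : 'rV[R]_d) (h : 'rV[R]_d -> R).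

Definition dotp u v : R := \sum_(i < d) u 0 i * v 0 i.

Lemma dotpC u v : dotp u v = dotp v u.
Proof. by apply: eq_bigr => i _; rewrite mulrC. Qed.

Lemma dotpDl u v w : dotp (u + v) w = dotp u w + dotp v w.
Proof. by rewrite -big_split; apply: eq_bigr => i _; rewrite mxE mulrDl. Qed.

Lemma dotpZl a u w : dotp (a *: u) w = a * dotp u w.
Proof. by rewrite mulr_sumr; apply: eq_bigr => i _; rewrite mxE mulrA. Qed.

Lemma dotpNl u w : dotp (- u) w = - dotp u w.
Proof. by rewrite -scaleN1r dotpZl mulN1r. Qed.

Lemma dotpBl u v w : dotp (u - v) w = dotp u w - dotp v w.
Proof. by rewrite dotpDl dotpNl. Qed.

Lemma dotp0 u : dotp 0 u = 0.
Proof. by rewrite -(subrr u) dotpBl subrr. Qed.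

Lemma dotpDr u v w : dotp w (u + v) = dotp w u + dotp w v.
Proof. by rewrite dotpC dotpDl !(dotpC _ w). Qed.

Lemma dotpZr a u w : dotp w (a *: u) = a * dotp w u.
Proof. by rewrite dotpC dotpZl (dotpC _ w). Qed.

Lemma dotpBr u v w : dotp w (u - v) = dotp w u - dotp w v.
Proof. by rewrite dotpC dotpBl !(dotpC _ w). Qed.

Lemma dotp_ge0 u : 0 <= dotp u u.
Proof. by apply: sumr_ge0 => i _; rewrite -expr2 sqr_ge0. Qed.

Lemma dotp_eq0 u : (dotp u u == 0) = (u == 0).
Proof.
apply/eqP/eqP => [u0|->]; last by apply: big1 => i _; rewrite mxE mul0r.
have sq0 i : true -> 0 <= u 0 i * u 0 i by rewrite -expr2 sqr_ge0.
apply/rowP => i; rewrite mxE; apply/eqP; rewrite -sqrf_eq0 expr2; apply/eqP.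
exact: (psumr_eq0P sq0 u0).
Qed.

Lemma enorm_sqr u : enorm u ^+ 2 = dotp u u.
Proof.
rewrite sqr_sqrtr; last by apply: sumr_ge0 => i _; rewrite sqr_ge0.
by apply: eq_bigr => i _; rewrite expr2.
Qed.

Lemma dotp_sqrB u v : dotp (u - v) (u - v) = dotp u u - 2 * dotp u v + dotp v v.
Proof. by rewrite !(dotpBl, dotpBr) (dotpC v u); ring. Qed.

Lemma dotp_sqrD_le u v : dotp (u + v) (u + v) <= 2 * dotp u u + 2 * dotp v v.
Proof.
have := dotp_ge0 (u - v).
by rewrite dotp_sqrB !(dotpDl, dotpDr) (dotpC v u); lra.
Qed.

(** Young's inequality takes the place of the Cauchy-Schwarz inequality.  The
    constant is L + 1 rather than L, so that later it can be divided by. *)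
Lemma dotp_grad_sub_le h (L : R) : 0 <= L -> lipschitz_grad L h ->
  forall x y, dotp (grad h x - grad h y) (x - y) <= (L + 1) * dotp (x - y) (x - y).
Proof.
move=> L0 hL x y; set u := _ - _; set v := x - y.
have uv : dotp u u <= L ^+ 2 * dotp v v.
  rewrite -!enorm_sqr -exprMn ler_pXn2r ?nnegrE ?mulr_ge0 ?sqrtr_ge0//.
  exact: hL.
have L1 : 0 < L + 1 by lra.
have := dotp_ge0 (u - (L + 1) *: v).
rewrite dotp_sqrB dotpZr dotpZl dotpZr => H.
have := dotp_ge0 v => v0.
rewrite -(ler_pM2l L1); have : 0 <= L * dotp v v by apply: mulr_ge0.
nra.
Qed.

Lemma differentiable_grad h x v : differentiable h x ->
  'D_v h x = dotp (grad h x) v.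
Proof.
move=> dh; rewrite deriveE// {1}(row_sum_delta v) linear_sum.
by apply: eq_bigr => i _; rewrite linearZ/= mxE deriveE// mulrC.
Qed.

(** The directional derivative is the limit of the difference quotients from the
    right, so a bound on the latter for small positive t is enough. *)
Lemma derive_le_slope h x v c : differentiable h x ->
  (forall t, 0 < t -> t < 1 -> h (t *: v + x) - h x <= t * c) ->
  dotp (grad h x) v <= c.
Proof.
move=> dh slope; rewrite -differentiable_grad//.
have /cvg_ex[/= l hl] : derivable h x v by exact/diff_derivable.
have hl' := cvg_dnbhs_at_right hl.
rewrite /derive (cvg_lim _ hl)// -(cvg_lim _ hl')//.
apply: limr_le; first by apply/cvg_ex; exists l.
near=> t.
have t0 : 0 < t by near: t; exact: nbhs_right_gt.
have t1 : t < 1 by near: t; exact: nbhs_right_lt.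
by rewrite /GRing.scale/= ler_pdivrMl// slope.
Unshelve. all: by end_near. Qed.

Lemma convex_grad_le h : C1 h -> convex_fun h ->
  forall x y, h x + dotp (grad h x) (y - x) <= h y.
Proof.
move=> [dh _] ch x y; rewrite -lerBrDl.
apply: derive_le_slope => // t t0 t1.
pose T := @Itv01 R t (ltW t0) (ltW t1).
have := ch T y x; rewrite !inE => /(_ I I).
rewrite convRE/= /conv/=.
have -> : t *: (y - x) + x = t *: y + (1 - t) *: x.
  by rewrite scalerBr scalerBl scale1r -addrA (addrC x).
rewrite /unstable.onem; lra.
Qed.

Lemma grad_minimizer h x : C1 h -> (forall y, h x <= h y) -> grad h x = 0.
Proof.
move=> [dh _] hmin.
have dhN : differentiable (- h) x by exact: differentiableN.
have N v : dotp (grad h x) v >= 0.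
  rewrite -differentiable_grad// -oppr_le0 -deriveN; last exact: diff_derivable.
  rewrite differentiable_grad//; apply: derive_le_slope => // t _ _.
  by rewrite mulr0 opprK addrC subr_le0 hmin.
apply/eqP; rewrite -dotp_eq0 eq_le dotp_ge0 andbT -oppr_ge0.
by rewrite -mulN1r -dotpZr N.
Qed.

(** Apply the gradient inequality at y and at the point w obtained from x by a
    gradient step for h - dotp (grad h y): going from x to w decreases that
    function, which is convex and minimal at y, by a multiple of the squared norm
    of its gradient.  The upper bound on h w comes from the gradient inequality at
    w and [dotp_grad_sub_le] rather than from the integral of the gradient over
    the segment; this gives 4 (L + 1) instead of the optimal 2 L. *)
Lemma cocoercive h (L : R) : 0 <= L -> C1 h -> lipschitz_grad L h -> convex_fun h ->
  forall x y, dotp (grad h x - grad h y) (grad h x - grad h y) <=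
    4 * (L + 1) * (h x - h y - dotp (grad h y) (x - y)).
Proof.
move=> L0 h1 hL ch x y; set g := grad h x - grad h y.
have L1 : 0 < L + 1 by lra.
pose t : R := (2 * (L + 1))^-1.
pose w := x - t *: g.
have wx : w - x = - (t *: g) by rewrite /w addrC addKr.
have H1 := convex_grad_le h1 ch y w.
have H2 := convex_grad_le h1 ch w x.
have H3 := dotp_grad_sub_le L0 hL w x.
have xw : x - w = t *: g by rewrite -opprB wx opprK.
have wy : w - y = (x - y) - t *: g by rewrite /w addrAC.
rewrite xw dotpZr in H2.
rewrite wx -scaleNr dotpZr dotpZl dotpZr dotpBl in H3.
rewrite wy dotpBr dotpZr in H1.
have gE : dotp g g = dotp (grad h x) g - dotp (grad h y) g by rewrite -dotpBl.
have tL : t * (L + 1) = 2^-1 by rewrite /t invfM -mulrA mulVf ?mulr1// gt_eqF.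
have g0 := dotp_ge0 g.
have t0 : 0 < t by rewrite invr_gt0; lra.
have : t * dotp g g / 2 <= h x - h y - dotp (grad h y) (x - y).
  move: H3.
  have -> : (L + 1) * (- t * (- t * dotp g g)) = t * dotp g g / 2.
    transitivity ((t * (L + 1)) * t * dotp g g); first by ring.
    by rewrite tL; ring.
  move=> H3.
  nra.
move=> H4; have : 4 * (L + 1) * (t * dotp g g / 2) = dotp g g.
  transitivity (2 * (t * (L + 1)) * dotp g g); first by field.
  by rewrite tL; field.
by move=> <-; rewrite ler_pM2l//; lra.
Qed.

End euclidean.

(** * Stochastic gradients at a fixed point *)

Section has_integral_theory.
Context (dT : measure_display) (T : measurableType dT) (R : realType).
Variable mu : probability T R.
Implicit Types (h k : T -> R) (v w : R).

Lemma has_integral_measurable h v : has_integral mu h v ->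
  measurable_fun [set: T] h.
Proof. by move=> [/measurable_int/measurable_EFinP]. Qed.

Lemma has_integral_cst v : has_integral mu (fun=> v) v.
Proof.
split; first exact: finite_measure_integrable_cst.
by rewrite integral_cst//= probability_setT mule1.
Qed.

Lemma has_integralD h k v w : has_integral mu h v -> has_integral mu k w ->
  has_integral mu (fun z => h z + k z) (v + w).
Proof.
move=> [ih hv] [ik kw]; split; first exact: (integrableD measurableT ih ik).
by rewrite EFinD -hv -kw -integralD_EFin.
Qed.

Lemma has_integralZ h v c : has_integral mu h v ->
  has_integral mu (fun z => c * h z) (c * v).
Proof.
move=> [ih hv]; split; first exact: (integrableZl measurableT c ih).
by rewrite EFinM -hv -integralZl.
Qed.

Lemma has_integral_sum n (h : 'I_n -> T -> R) (v : 'I_n -> R) :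
  (forall i, has_integral mu (h i) (v i)) ->
  has_integral mu (fun z => \sum_(i < n) h i z) (\sum_(i < n) v i).
Proof.
elim: n h v => [|n IH] h v hv.
  rewrite big_ord0; have -> : (fun z => \sum_(i < 0) h i z) = (fun=> 0).
    by apply/funext => z; rewrite big_ord0.
  exact: has_integral_cst.
rewrite big_ord_recr.
have -> : (fun z => \sum_(i < n.+1) h i z) =
    (fun z => \sum_(i < n) h (widen_ord (leqnSn n) i) z + h ord_max z).
  by apply/funext => z; rewrite big_ord_recr.
by apply: has_integralD => //; apply: IH.
Qed.

Lemma has_integral_le h k v w : has_integral mu h v -> has_integral mu k w ->
  (forall z, h z <= k z) -> v <= w.
Proof.
move=> [ih hv] [ik kw] hk; rewrite -lee_fin -hv -kw.
by apply: le_integral => // z _; rewrite lee_fin.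
Qed.

(** A finite upper bound on the integral of a nonnegative function yields
    integrability, hence the relation [has_integral] that supports linear
    combinations. *)
Lemma ge0_has_integral h v : measurable_fun [set: T] h -> (forall z, 0 <= h z) ->
  (\int[mu]_z (h z)%:E <= v%:E)%E ->
  exists2 w, has_integral mu h w & w <= v.
Proof.
move=> mh h0 hv.
have i0 : (0 <= \int[mu]_z (h z)%:E)%E.
  by apply: integral_ge0 => z _; rewrite lee_fin.
have ifin : (\int[mu]_z (h z)%:E)%E \is a fin_num.
  by rewrite ge0_fin_numE// (le_lt_trans hv)// ltry.
exists (fine (\int[mu]_z (h z)%:E)%E); last by rewrite -lee_fin fineK.
split; last by rewrite fineK.
apply/integrableP; split; first exact/measurable_EFinP.
under eq_integral => z _ do rewrite /= ger0_norm//.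
by rewrite (le_lt_trans hv)// ltry.
Qed.

Lemma has_integral_dotp d (h : T -> 'rV[R]_d) g u : has_vintegral mu h g ->
  has_integral mu (fun z => dotp (h z) u) (dotp g u).
Proof.
move=> hg; apply: has_integral_sum => i.
have -> : (fun z => h z 0 i * u 0 i) = (fun z => u 0 i * h z 0 i).
  by apply/funext => z; rewrite mulrC.
by rewrite mulrC; exact/has_integralZ/hg.
Qed.

Lemma measurable_dotp d (h k : T -> 'rV[R]_d) :
  (forall i, measurable_fun [set: T] (fun z => h z 0 i)) ->
  (forall i, measurable_fun [set: T] (fun z => k z 0 i)) ->
  measurable_fun [set: T] (fun z => dotp (h z) (k z)).
Proof.
by move=> mh mk; apply: measurable_sum => i; apply: measurable_funM.
Qed.

Lemma has_vintegral_measurable d (h : T -> 'rV[R]_d) g : has_vintegral mu h g ->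
  forall i, measurable_fun [set: T] (fun z => h z 0 i).
Proof. by move=> hg i; apply: has_integral_measurable (hg i). Qed.

End has_integral_theory.

Section stochastic_gradient.
Context (dT : measure_display) (T : measurableType dT) (R : realType).
Variables (mu : probability T R) (d : nat).
Implicit Types (f : 'rV[R]_d -> R) (H : 'rV[R]_d -> T -> 'rV[R]_d).

Definition second_moment_le H x (v : R) :=
  exists2 w, has_integral mu (fun z => dotp (H x z) (H x z)) w & w <= v.

Lemma second_moment_dominated (h : T -> 'rV[R]_d) (k : T -> R) v w :
  (forall i, measurable_fun [set: T] (fun z => h z 0 i)) ->
  has_integral mu k w -> (forall z, dotp (h z) (h z) <= k z) -> w <= v ->
  exists2 w', has_integral mu (fun z => dotp (h z) (h z)) w' & w' <= v.
Proof.
move=> mh ik hk wv; apply: ge0_has_integral.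
- exact: measurable_dotp.
- by move=> z; exact: dotp_ge0.
- rewrite (@le_trans _ _ w%:E)//; case: (ik) => [jk <-].
  apply: ge0_le_integral => //.
  + by move=> z _; rewrite lee_fin dotp_ge0.
  + exact/measurable_EFinP/measurable_dotp.
  + exact: measurable_int jk.
  + by move=> z _; rewrite lee_fin.
Qed.

(** Split H into its error and its mean: |H|^2 <= 2 |H - grad f|^2 + 2 |grad f|^2.
    As grad f xstar = 0, cocoercivity at x and xstar bounds |grad f x|^2 by the
    gap f x - f xstar. *)
Lemma second_moment_variance f (L : R) xstar H (eta : R) :
  0 <= L -> C1 f -> lipschitz_grad L f -> convex_fun f ->
  (forall x, f xstar <= f x) ->
  (forall x, has_vintegral mu (H x) (grad f x)) ->
  (forall x, (\int[mu]_z (enorm (H x z - grad f x) ^+ 2)%:E <= eta%:E)%E) ->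
  forall x, second_moment_le H x (8 * (L + 1) * (f x - f xstar) + 2 * eta).
Proof.
move=> L0 f1 fL cf fmin Hg Heta x.
have mH := has_vintegral_measurable (Hg x).
have mHg i : measurable_fun [set: T] (fun z => (H x z - grad f x) 0 i).
  under eq_fun do rewrite !mxE; exact: measurable_funB.
have [w iw weta] : exists2 w, has_integral mu
    (fun z => dotp (H x z - grad f x) (H x z - grad f x)) w & w <= eta.
  apply: ge0_has_integral; first exact: measurable_dotp.
    by move=> z; exact: dotp_ge0.
  by under eq_integral do rewrite -enorm_sqr; exact: Heta.
apply: (second_moment_dominated mH).
- apply: has_integralD; first exact: (has_integralZ 2 iw).
  exact: (has_integral_cst mu (2 * dotp (grad f x) (grad f x))).
- by move=> z; rewrite -{1 2}(subrK (grad f x) (H x z)) dotp_sqrD_le.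
- have := cocoercive L0 f1 fL cf x xstar.
  by rewrite (grad_minimizer f1 fmin) subr0 dotpC -[0]subr0 dotpBr subrr; lra.
Qed.

(** Cocoercivity holds for each function ft ^~ z.  Integrated over z, it bounds the
    mean of |H x z - H y z|^2 by a multiple of f x - f y - dotp (grad f y) (x - y).
    This transports a second moment bound from xbar to xstar, and then from xstar to
    any x; in the second transport the linear term vanishes. *)
Lemma second_moment_random_functions f (L : R) xstar (ft : 'rV[R]_d -> T -> R) xbar
    (eta : R) (H := fun x z => grad (ft ^~ z) x) :
  0 <= L -> grad f xstar = 0 ->
  (forall z, C1 (ft ^~ z) /\ lipschitz_grad L (ft ^~ z)) ->
  (forall z, convex_fun (ft ^~ z)) ->
  (forall x, has_integral mu (ft x) (f x)) ->
  (forall x, has_vintegral mu (H x) (grad f x)) ->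
  (\int[mu]_z (enorm (H xbar z) ^+ 2)%:E <= eta%:E)%E ->
  exists2 B, 0 <= B & forall x,
    second_moment_le H x (8 * (L + 1) * (f x - f xstar) + B).
Proof.
move=> L0 g0 ft1 cft If Ig Heta.
have mH x := has_vintegral_measurable (Ig x).
have [w iw weta] : second_moment_le H xbar eta.
  apply: ge0_has_integral; first by apply: measurable_dotp; exact: mH.
    by move=> z; exact: dotp_ge0.
  by under eq_integral do rewrite -enorm_sqr; exact: Heta.
have ic x y : has_integral mu
    (fun z => 4 * (L + 1) * (ft x z + -1 * ft y z + -1 * dotp (H y z) (x - y)))
    (4 * (L + 1) * (f x + -1 * f y + -1 * dotp (grad f y) (x - y))).
  apply: has_integralZ; apply: has_integralD.
    by apply: has_integralD => //; exact: has_integralZ.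
  exact/has_integralZ/has_integral_dotp.
have co x y z : dotp (H x z - H y z) (H x z - H y z) <=
    4 * (L + 1) * (ft x z + -1 * ft y z + -1 * dotp (H y z) (x - y)).
  by have [h1 h2] := ft1 z; rewrite !mulN1r; exact: (cocoercive L0 h1 h2 (cft z)).
have transport x y v : second_moment_le H y v -> second_moment_le H x
    (2 * (4 * (L + 1) * (f x + -1 * f y + -1 * dotp (grad f y) (x - y))) + 2 * v).
  move=> [v' iv' v'v]; apply: (second_moment_dominated (mH x)).
  - apply: has_integralD; first exact: (has_integralZ 2 (ic x y)).
    exact: (has_integralZ 2 iv').
  - move=> z; rewrite -{1 2}(subrK (H y z) (H x z)).
    by apply: le_trans (dotp_sqrD_le _ _) _; have := co x y z; lra.
  - by rewrite lerD2l ler_pM2l.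
have /transport-/(_ xstar) : second_moment_le H xbar eta by exists w.
set B := 2 * _ + 2 * eta => -[w' iw' w'B].
have B0 : 0 <= B.
  apply: le_trans w'B; apply: has_integral_le (has_integral_cst mu 0) iw' _.
  by move=> z; exact: dotp_ge0.
exists (2 * B); first by rewrite mulr_ge0.
move=> x; have /transport-/(_ x) : second_moment_le H xstar B by exists w'.
rewrite g0 -[X in dotp X _]subr0 dotpBl subrr.
by congr second_moment_le; ring.
Qed.

Lemma has_integral_step (h : T -> 'rV[R]_d) g v (x u : 'rV[R]_d) (c : R) :
  has_vintegral mu h g -> has_integral mu (fun z => dotp (h z) (h z)) v ->
  has_integral mu (fun z => dotp (x - c *: h z - u) (x - c *: h z - u))
    (dotp (x - u) (x - u) - 2 * c * dotp g (x - u) + c ^+ 2 * v).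
Proof.
move=> hg hv.
have -> : (fun z => dotp (x - c *: h z - u) (x - c *: h z - u)) =
  (fun z => dotp (x - u) (x - u) + - (2 * c) * dotp (h z) (x - u)
     + c ^+ 2 * dotp (h z) (h z)).
  apply/funext => z; rewrite (addrAC x) (dotp_sqrB (x - u)) !(dotpZr, dotpZl).
  by rewrite (dotpC (x - u) (h z)); ring.
rewrite -(mulNr (2 * c) (dotp g _)); apply: has_integralD; last exact: has_integralZ.
by apply: has_integralD; [exact: has_integral_cst|exact/has_integralZ/has_integral_dotp].
Qed.

End stochastic_gradient.

(** * Borel measurability of vector-valued maps *)

Section borel_measurability.
Context (R : realType).

Lemma continuous_borel_measurable (S : ptopologicalType) (f : S -> R) :
  continuous f -> measurable_fun [set: borel S] f.
Proof.
move=> cf; apply: (measurability _ (RGenOInfty.measurableE R)).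
move=> _ [_ [x ->] <-]; rewrite setTI; apply: sub_sigma_algebra.
by move/continuousP : cf; apply; exact: interval_open.
Qed.

Lemma borel_coord_measurable d (i : 'I_d) :
  measurable_fun [set: borel 'rV[R]_d] (fun x : borel 'rV[R]_d => x 0 i).
Proof. by apply: continuous_borel_measurable; exact: coord_continuous. Qed.

(** The balls of the sup norm are boxes, so this writes an open set as a countable
    union of sets that are described coordinate by coordinate. *)
Lemma open_rV_bigcup_rational_ball d (U : set 'rV[R]_d) : open U ->
  U = \bigcup_(p in [set p : 'rV[rat]_d * nat |
        ball (map_mx ratr p.1 : 'rV[R]_d) p.2.+1%:R^-1 `<=` U])
        ball (map_mx ratr p.1 : 'rV[R]_d) p.2.+1%:R^-1.
Proof.
move=> oU; apply/seteqP; split => [x Ux|x [p pU]]; last exact: pU.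
have /nbhs_ballP[e /= e0 xeU] : nbhs x U by exact: open_nbhs_nbhs.
pose n := Num.truncn (2 / e).
have ne : n.+1%:R^-1 < e / 2.
  by rewrite -(invf_div 2 e) ltf_pV2 ?posrE ?divr_gt0// truncnS_gt.
have n0 : 0 < n.+1%:R^-1 :> R by rewrite invr_gt0.
have /choice[q xq] : forall i : 'I_d, exists q : rat,
    ball (x 0 i) n.+1%:R^-1 (ratr q : R).
  move=> i; have oB := ball_open (x 0 i) n.+1%:R^-1.
  have B0 : ball (x 0 i) (n.+1%:R^-1 : R) !=set0 by exists (x 0 i); exact: ballxx.
  by have [r [/= xq [q _ qE]]] := dense_rat B0 oB; exists q; rewrite qE.
have xqn : ball (map_mx ratr (\row_i q i) : 'rV[R]_d) n.+1%:R^-1 x.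
  by split => // i j; rewrite !mxE (ord1 i); apply: ball_sym; exact: xq.
exists (\row_i q i, n) => //= y qy; apply: xeU.
apply: (@le_ball _ _ _ (n.+1%:R^-1 + n.+1%:R^-1)); first by rewrite (splitr e) lerD// ltW.
by apply: ball_triangle qy; exact: ball_sym.
Qed.

(** The update of the iterates is measurable coordinatewise, by the arithmetic of
    real-valued measurable functions, whereas its joint measurability with H is
    stated for the Borel sets of the space. *)
Lemma measurable_rowP d (dT : measure_display) (T : measurableType dT)
    (h : T -> 'rV[R]_d) :
  measurable_fun [set: T] (h : T -> borel 'rV[R]_d) <->
  forall i, measurable_fun [set: T] (fun z => h z 0 i).
Proof.
split => [mh i|mh].
  exact: (measurableT_comp (borel_coord_measurable i) mh).
apply: (@measurability _ _ T (borel 'rV[R]_d) setT h _ erefl).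
move=> _ [U oU <-]; rewrite setTI (open_rV_bigcup_rational_ball oU).
rewrite preimage_bigcup bigcup_mkcond; apply: countable_bigcupT_measurable.
  exact: countableP.
move=> [q n]; case: ifP => // _ /=.
have -> : h @^-1` ball (map_mx ratr q : 'rV[R]_d) n.+1%:R^-1 =
    \bigcap_(i in [set: 'I_d]) (fun z => h z 0 i) @^-1` ball (ratr (q 0 i) : R) n.+1%:R^-1.
  apply/seteqP; split => [z [_ zq] i _|z zq]; first by have := zq 0 i; rewrite mxE.
  by split => // i j; rewrite mxE (ord1 i); exact: zq.
apply: fin_bigcap_measurable => // i _.
rewrite -[X in measurable X]setTI; apply: mh => //.
exact: measurable_ball.
Qed.

End borel_measurability.

(** * Independence of the noise from the past *)

Section independent_integral.
Context (dO d1 d2 : measure_display) (Omega : measurableType dO)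
  (T1 : measurableType d1) (T2 : measurableType d2) (R : realType).
Variables (P : probability Omega R) (Y : {RV P >-> T1}) (Z : {RV P >-> T2}).
Variable (nu : probability T2 R).

Hypothesis YZ : forall A B, measurable A -> measurable B ->
  P (Y @^-1` A `&` Z @^-1` B) = (P (Y @^-1` A) * nu B)%E.

(** The law of (Y, Z) is the product of the law of Y and nu, because they agree on
    rectangles; then Tonelli. *)
Lemma ge0_integral_indep (phi : T1 * T2 -> \bar R) :
  measurable_fun [set: T1 * T2] phi -> (forall p, (0 <= phi p)%E) ->
  (\int[P]_w phi (Y w, Z w) = \int[P]_w \int[nu]_z phi (Y w, z))%E.
Proof.
move=> mphi phi0.
have mYZ : measurable_fun [set: Omega] (fun w => (Y w, Z w)).
  by apply: measurable_fun_pair; exact: measurable_funP.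
pose YZmf : {mfun Omega >-> (T1 * T2)%type} :=
  HB.pack (fun w => (Y w, Z w)) (isMeasurableFun.Build _ _ _ _ _ mYZ).
transitivity (\int[distribution P Y \x nu]_p phi p)%E.
  rewrite (eq_measure_integral (distribution P YZmf)).
    by rewrite ge0_integral_distribution.
  move=> A mA _; exact: product_measure_unique.
rewrite fubini_tonelli1// ge0_integral_distribution//.
  exact: measurable_fun_fubini_tonelli_F.
by move=> y; apply: integral_ge0.
Qed.

End independent_integral.

Section past.
Context (dO dS : measure_display) (Omega : measurableType dO)
  (S : measurableType dS) (R : realType) (P : probability Omega R).
Variables (Z : nat -> {RV P >-> S}).
Hypothesis Zind : mutually_independent P (fun n => Z n : Omega -> S).

Definition cylinder (A : nat -> set S) n : set Omega :=
  \big[setI/setT]_(j <- iota 0 n.+1) (Z j @^-1` A j).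

Definition past_cylinders n : set (set Omega) :=
  [set cylinder A n | A in [set A | forall j, measurable (A j)]].

(** A copy of Omega with the sigma-algebra generated by Z 0, ..., Z n. *)
Definition past n := g_sigma_algebraType (past_cylinders n).

Lemma measurable_preimage n (B : set S) : measurable B -> measurable (Z n @^-1` B).
Proof. by move=> mB; rewrite -[X in measurable X]setTI; exact: measurable_funP. Qed.

Lemma past_cylinders_setI n : setI_closed (past_cylinders n).
Proof.
move=> _ _ [A mA <-] [B mB <-]; exists (fun j => A j `&` B j).
  by move=> j; exact: measurableI.
by rewrite /cylinder -big_split.
Qed.

Lemma past_cylinders_measurable n : past_cylinders n `<=` measurable.
Proof.
move=> _ [A mA <-]; apply: bigsetI_measurable => j _; exact: measurable_preimage.
Qed.

Lemma past_measurable n (E : set Omega) : measurable (E : set (past n)) ->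
  measurable E.
Proof.
move: E; apply: smallest_sub; last exact: past_cylinders_measurable.
exact: sigma_algebra_measurable.
Qed.

(** Both sides are equal for cylinders by mutual independence of the family; the
    cylinders are closed under intersection, and the sets E for which equality
    holds form a Dynkin system. *)
Lemma past_independent n (E : set Omega) (B : set S) :
  measurable (E : set (past n)) -> measurable B ->
  P (E `&` Z n.+1 @^-1` B) = (P E * P (Z n.+1 @^-1` B))%E.
Proof.
move=> mE mB; set C := Z n.+1 @^-1` B.
have mC : measurable C by exact: measurable_preimage.
have fP A : measurable A -> P A \is a fin_num by exact: fin_num_measure.
suff : <<s past_cylinders n >> `<=`
    [set E | measurable E /\ P (E `&` C) = (P E * P C)%E] by move=> /(_ _ mE)[].
rewrite -setI_closed_g_dynkin_g_sigma_algebra; last exact: past_cylinders_setI.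
apply: smallest_sub; last first.
  move=> E' cE; split; first exact: past_cylinders_measurable cE.
  move: cE => [A mA <-].
  pose A' j := if j == n.+1 then B else A j.
  have mA' j : measurable (A' j) by rewrite /A'; case: ifP.
  have A'E j : j \in iota 0 n.+1 -> A' j = A j.
    by rewrite mem_iota /A'; case: eqP => // ->; rewrite add0n ltnn.
  have A'n : A' n.+1 = B by rewrite /A' eqxx.
  have := Zind (iota_uniq 0 n.+2) mA'.
  rewrite -{1 2}[n.+2]addn1 iotaD !big_cat/= !big_seq1 add0n A'n.
  have := Zind (iota_uniq 0 n.+1) mA.
  rewrite /cylinder => ->.
  rewrite 2![in X in X -> _]big_seq.
  under eq_bigr => j /A'E -> do [].
  under [X in _ = (X * _)%E -> _]eq_bigr => j /A'E -> do [].
  by rewrite -!big_seq.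
split.
- by split; [exact: measurableT|rewrite setTI probability_setT mul1e].
- move=> E' [mE' EC]; split; first exact: measurableC.
  rewrite probability_setC// setIC -setDE measureD//; last first.
    by rewrite ltey_eq fP.
  rewrite (setIC C) [X in (_ - X)%E]EC muleBl ?fP ?mul1e//.
- move=> F tF FC.
  have mF i : measurable (F i) by have [] := FC i.
  split; first exact: bigcupT_measurable.
  rewrite setI_bigcupl !measure_bigcup//; last 2 first.
  + by move=> i _; exact: measurableI.
  + exact: trivIset_setIr.
  rewrite [LHS](@eq_eseriesr _ _ (fun i => (fine (P C))%:E * P (F i))%E); last first.
    by move=> i _; rewrite fineK ?fP// muleC; exact: (FC i).2.
  by rewrite nneseriesZl// muleC fineK ?fP.
Qed.

End past.

(** * Mean recursions of the iterates *)

Section sgd.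
Context (dO dS : measure_display) (Omega : measurableType dO)
  (S : measurableType dS) (R : realType) (P : probability Omega R) (d : nat).
Variables (Z : nat -> {RV P >-> S}) (nu : probability S R).
Hypothesis Zind : mutually_independent P (fun n => Z n : Omega -> S).
Hypothesis Zlaw : forall n B, measurable B -> P (Z n @^-1` B) = nu B.

Variables (H : 'rV[R]_d -> S -> 'rV[R]_d) (c : nat -> R).
Hypothesis mH : measurable_fun [set: borel 'rV[R]_d * S]
  (fun p : borel 'rV[R]_d * S => H p.1 p.2 : borel 'rV[R]_d).
Variables (x0 : 'rV[R]_d) (X : nat -> Omega -> 'rV[R]_d).
Hypothesis X_0 : forall w, X 0%N w = x0.
Hypothesis X_S : forall n w, X n.+1 w = X n w - c n *: H (X n w) (Z n.+1 w).

Lemma past_measurable_id n : measurable_fun [set: Omega] (id : Omega -> past Z n).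
Proof.
by move=> _ E mE; rewrite setTI; exact: (@past_measurable _ _ _ _ _ _ Z n).
Qed.

(** A cylinder over Z 0, ..., Z m is also one over Z 0, ..., Z n, with no constraint
    on the additional coordinates. *)
Lemma past_le n m : (m <= n)%N ->
  measurable_fun [set: past Z n] (id : past Z n -> past Z m).
Proof.
move=> mn; apply: (@measurability _ _ (past Z n) (past Z m) setT id _ erefl).
move=> _ [_ [A mA <-] <-]; rewrite setTI; apply: sub_sigma_algebra.
exists (fun j => if (j <= m)%N then A j else setT).
  by move=> j; case: ifP.
rewrite /cylinder preimage_id.
have -> : n.+1 = (m.+1 + (n - m))%N by rewrite addSn subnKC.
rewrite iotaD big_cat/= add0n [X in _ `&` X]big1_seq ?setIT.
  rewrite !big_seq; apply: eq_bigr => j.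
  by rewrite -[_ :: _]/(iota 0 m.+1) mem_iota => /andP[_]; rewrite add0n ltnS => ->.
by move=> j; rewrite mem_iota => /andP[_ /andP[mj _]]; rewrite leqNgt mj.
Qed.

Lemma past_last n : measurable_fun [set: past Z n] (Z n : past Z n -> S).
Proof.
move=> _ B mB; rewrite setTI; apply: sub_sigma_algebra.
exists (fun j => if j == n then B else setT); first by move=> j; case: ifP.
rewrite /cylinder -addn1 iotaD big_cat/= big_seq1 add0n eqxx big1_seq ?setTI//.
by move=> j; rewrite mem_iota => /andP[_ /andP[_ jn]]; rewrite ltn_eqF.
Qed.

Lemma iterate_past n m : (m <= n)%N ->
  measurable_fun [set: past Z n] (X m : past Z n -> borel 'rV[R]_d).
Proof.
elim: m n => [|m IH] n mn.
  by rewrite (_ : X 0%N = fun=> x0); [exact: measurable_cst|apply/funext].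
have mX := IH n (ltnW mn).
have mZ : measurable_fun [set: past Z n] (Z m.+1 : past Z n -> S).
  exact: (measurableT_comp (@past_last m.+1) (past_le mn)).
rewrite (_ : X m.+1 = fun w => X m w - c m *: H (X m w) (Z m.+1 w)); last first.
  exact/funext.
apply/measurable_rowP => i; under eq_fun do rewrite !mxE.
apply: measurable_funB; first by move/measurable_rowP : mX.
apply: measurable_funM => //.
have : measurable_fun [set: past Z n]
    (fun w => H (X m w) (Z m.+1 w) : borel 'rV[R]_d).
  exact: (measurableT_comp mH (measurable_fun_pair mX mZ)).
by move/measurable_rowP.
Qed.

Lemma iterate_measurable n :
  measurable_fun [set: Omega] (X n : Omega -> borel 'rV[R]_d).
Proof. exact: (measurableT_comp (iterate_past (leqnn n)) (@past_measurable_id n)). Qed.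

Lemma past_ge0_integral n (phi : past Z n * S -> \bar R) :
  measurable_fun [set: past Z n * S] phi -> (forall p, (0 <= phi p)%E) ->
  (\int[P]_w phi (w, Z n.+1 w) = \int[P]_w \int[nu]_z phi (w, z))%E.
Proof.
move=> mphi phi0.
pose Y : {mfun Omega >-> past Z n} := HB.pack (id : Omega -> past Z n)
  (isMeasurableFun.Build _ _ _ _ _ (@past_measurable_id n)).
apply: (@ge0_integral_indep _ _ _ _ _ _ _ P Y (Z n.+1)) => // A B mA mB.
by rewrite past_independent// Zlaw.
Qed.

(** The function phi stands for f - f xstar, and g for the gradient of f. *)
Variables (phi : 'rV[R]_d -> R) (g : 'rV[R]_d -> 'rV[R]_d) (A B : R).
Hypothesis mphi : measurable_fun [set: borel 'rV[R]_d] phi.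
Hypothesis phi0 : forall x, 0 <= phi x.
Hypothesis phi_grad : forall x u, phi x - phi u <= dotp (g x) (x - u).
Hypotheses (A0 : 0 <= A) (B0 : 0 <= B).
Hypothesis Hmean : forall x, has_vintegral nu (H x) (g x).
Hypothesis Hsq : forall x, second_moment_le nu H x (A * phi x + B).
Hypothesis c0 : forall n, 0 <= c n.

Definition mean_gap n : \bar R := (\int[P]_w (phi (X n w))%:E)%E.
Definition mean_sqdist n (Y : Omega -> 'rV[R]_d) : \bar R :=
  (\int[P]_w (dotp (X n w - Y w) (X n w - Y w))%:E)%E.

Lemma mean_gap_ge0 n : (0 <= mean_gap n)%E.
Proof. by apply: integral_ge0 => w _; rewrite lee_fin. Qed.

Lemma mean_sqdist_ge0 n Y : (0 <= mean_sqdist n Y)%E.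
Proof. by apply: integral_ge0 => w _; rewrite lee_fin dotp_ge0. Qed.

(** For a fixed past, integrating over the noise replaces H by its mean g in the
    cross term of |X_n - c_n H - Y|^2, and the gradient inequality turns this
    cross term into the gap between X_n and Y.  The terms are arranged so as to
    be nonnegative on both sides, which makes the integration over the past
    valid before any of them is known to be finite. *)
Lemma mean_sqdist_step n (Y : Omega -> 'rV[R]_d) :
  measurable_fun [set: past Z n] (Y : past Z n -> borel 'rV[R]_d) ->
  (mean_sqdist n.+1 Y + (2 * c n)%:E * mean_gap n <= mean_sqdist n Y +
    (2 * c n)%:E * \int[P]_w (phi (Y w))%:E +
    (c n ^+ 2)%:E * (A%:E * mean_gap n + B%:E))%E.
Proof.
move=> mY.
pose psi (p : past Z n * S) :=
  (dotp (X n p.1 - c n *: H (X n p.1) p.2 - Y p.1)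
        (X n p.1 - c n *: H (X n p.1) p.2 - Y p.1))%:E.
have mX := iterate_past (leqnn n).
have toO (h : Omega -> borel 'rV[R]_d) :
    measurable_fun [set: past Z n] (h : past Z n -> _) ->
    forall i, measurable_fun [set: Omega] (fun w => h w 0 i).
  move=> mh; apply/measurable_rowP.
  exact: (measurableT_comp mh (@past_measurable_id n)).
have mXi := toO _ mX. have mYi := toO _ mY.
have mphiX : measurable_fun [set: Omega] (fun w => (phi (X n w))%:E).
  exact/measurable_EFinP/(measurableT_comp mphi)/iterate_measurable.
have mphiY : measurable_fun [set: Omega] (fun w => (phi (Y w))%:E).
  apply/measurable_EFinP/(measurableT_comp mphi).
  exact: (measurableT_comp mY (@past_measurable_id n)).
have mXY : measurable_fun [set: Omega]
    (fun w => (dotp (X n w - Y w) (X n w - Y w))%:E).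
  apply/measurable_EFinP/measurable_dotp => i;
    under eq_fun do rewrite !mxE; exact: measurable_funB.
have mpsi : measurable_fun [set: past Z n * S] psi.
  have m1 (h : past Z n -> 'rV[R]_d) :
      measurable_fun [set: past Z n] (h : _ -> borel 'rV[R]_d) ->
      forall i, measurable_fun [set: past Z n * S] (fun p => h p.1 0 i).
    by move=> mh; apply/measurable_rowP; exact: (measurableT_comp mh measurable_fst).
  have mHp : forall i, measurable_fun [set: past Z n * S]
      (fun p => H (X n p.1) p.2 0 i).
    have mXfst := measurableT_comp mX (@measurable_fst _ _ (past Z n) S).
    apply/measurable_rowP.
    exact: (measurableT_comp mH (measurable_fun_pair mXfst measurable_snd)).
  apply/measurable_EFinP/measurable_dotp => i; under eq_fun do rewrite !mxE.
    apply: measurable_funB; last exact: m1.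
    by apply: measurable_funB; [exact: m1|apply: measurable_funM].
  apply: measurable_funB; last exact: m1.
  by apply: measurable_funB; [exact: m1|apply: measurable_funM].
have psi0 p : (0 <= psi p)%E by rewrite lee_fin dotp_ge0.
have -> : (mean_sqdist n.+1 Y = \int[P]_w \int[nu]_z psi (w, z))%E.
  rewrite -(past_ge0_integral mpsi psi0).
  by apply: eq_integral => w _; rewrite /psi/= X_S.
have mint : measurable_fun [set: Omega] (fun w => \int[nu]_z psi (w, z))%E.
  exact: (measurableT_comp (measurable_fun_fubini_tonelli_F psi mpsi psi0)
    (@past_measurable_id n)).
have int0 w : (0 <= \int[nu]_z psi (w, z))%E by apply: integral_ge0.
have c20 : 0 <= 2 * c n by rewrite mulr_ge0.
have inner w : (\int[nu]_z psi (w, z) + ((2 * c n)%:E * (phi (X n w))%:E) <=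
    (dotp (X n w - Y w) (X n w - Y w))%:E + (2 * c n)%:E * (phi (Y w))%:E +
    (c n ^+ 2)%:E * (A%:E * (phi (X n w))%:E + B%:E))%E.
  have [v iv vAB] := Hsq (X n w).
  have [_ ->] := has_integral_step (X n w) (Y w) (c n) (Hmean (X n w)) iv.
  rewrite -!EFinM -!EFinD lee_fin.
  have := phi_grad (X n w) (Y w); have := c0 n; have := sqr_ge0 (c n).
  nra.
have c2e : (0 <= (2 * c n)%:E)%E by rewrite lee_fin.
have cce : (0 <= (c n ^+ 2)%:E)%E by rewrite lee_fin sqr_ge0.
have Ae : (0 <= A%:E)%E by rewrite lee_fin.
have Be : (0 <= B%:E)%E by rewrite lee_fin.
have phie x : (0 <= (phi x)%:E)%E by rewrite lee_fin.
have dote w : (0 <= (dotp (X n w - Y w) (X n w - Y w))%:E)%E by rewrite lee_fin dotp_ge0.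
have mZl (h : Omega -> \bar R) (k : R) : measurable_fun setT h ->
    measurable_fun setT (fun w => k%:E * h w)%E.
  by move=> mh; exact: measurable_funeM.
have mAB : measurable_fun setT (fun w => A%:E * (phi (X n w))%:E + B%:E)%E.
  by apply: emeasurable_funD => //; exact: mZl.
have AB0 w : (0 <= A%:E * (phi (X n w))%:E + B%:E)%E by rewrite adde_ge0 ?mule_ge0.
have mR1 : measurable_fun setT (fun w => (dotp (X n w - Y w) (X n w - Y w))%:E
    + (2 * c n)%:E * (phi (Y w))%:E)%E.
  by apply: emeasurable_funD => //; exact: mZl.
have L : (\int[P]_w (\int[nu]_z psi (w, z) + ((2 * c n)%:E * (phi (X n w))%:E)) =
    \int[P]_w \int[nu]_z psi (w, z) + (2 * c n)%:E * mean_gap n)%E.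
  rewrite ge0_integralD//; [by rewrite ge0_integralZl|..|exact: mZl].
  by move=> w _; rewrite mule_ge0.
have -> : (mean_sqdist n Y + (2 * c n)%:E * \int[P]_w (phi (Y w))%:E +
    (c n ^+ 2)%:E * (A%:E * mean_gap n + B%:E) =
    \int[P]_w ((dotp (X n w - Y w) (X n w - Y w))%:E + (2 * c n)%:E * (phi (Y w))%:E +
    (c n ^+ 2)%:E * (A%:E * (phi (X n w))%:E + B%:E)))%E.
  rewrite [RHS]ge0_integralD//; last 3 first.
  - by move=> w _; rewrite adde_ge0 ?mule_ge0.
  - by move=> w _; rewrite mule_ge0.
  - exact: mZl.
  rewrite [in RHS]ge0_integralD//; last 2 first.
  - by move=> w _; rewrite mule_ge0.
  - exact: mZl.
  rewrite !ge0_integralZl// ge0_integralD//; last 2 first.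
  - by move=> w _; rewrite mule_ge0.
  - exact: mZl.
  by rewrite ge0_integralZl// integral_cst//= probability_setT mule1.
rewrite -L; apply: ge0_le_integral => //.
- by move=> w _; rewrite adde_ge0 ?mule_ge0.
- by apply: emeasurable_funD => //; exact: mZl.
- by apply: emeasurable_funD => //; exact: mZl.
Qed.

Variables (xs : 'rV[R]_d) (K : R).
Hypotheses (phi_xs : phi xs = 0) (K0 : 0 <= K).
Hypothesis phi_quad : forall x, phi x <= K * dotp (x - xs) (x - xs).

Lemma mean_sqdist_step_min n :
  (mean_sqdist n.+1 (cst xs) + (2 * c n)%:E * mean_gap n <= mean_sqdist n (cst xs) +
    (c n ^+ 2)%:E * (A%:E * mean_gap n + B%:E))%E.
Proof.
have := @mean_sqdist_step n (cst xs) (measurable_cst _).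
by under eq_integral do rewrite phi_xs; rewrite integral0 mule0 adde0.
Qed.

(** Together with [mean_sqdist_step_min], this propagates finiteness from one
    iterate to the next. *)
Lemma mean_gap_le_sqdist n : (mean_gap n <= K%:E * mean_sqdist n (cst xs))%E.
Proof.
have mX i : measurable_fun [set: Omega] (fun w => X n w 0 i).
  by move: i; apply/measurable_rowP; exact: iterate_measurable.
have mXx : measurable_fun [set: Omega]
    (fun w => (dotp (X n w - xs) (X n w - xs))%:E).
  apply/measurable_EFinP/measurable_dotp => i;
    under eq_fun do rewrite !mxE; exact: measurable_funB.
rewrite /mean_sqdist -ge0_integralZl//; last by move=> w _; rewrite lee_fin dotp_ge0.
apply: ge0_le_integral => //.
- by move=> w _; rewrite lee_fin.
- exact/measurable_EFinP/(measurableT_comp mphi)/iterate_measurable.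
- exact: measurable_funeM.
- by move=> w _; rewrite -EFinM lee_fin.
Qed.

Lemma mean_sqdist_min_fin n : mean_sqdist n (cst xs) \is a fin_num.
Proof.
elim: n => [|n IH].
  rewrite /mean_sqdist; under eq_integral do rewrite X_0 /=.
  by rewrite integral_cst//= probability_setT mule1.
have gfin : mean_gap n \is a fin_num.
  rewrite ge0_fin_numE ?mean_gap_ge0// (le_lt_trans (mean_gap_le_sqdist n))//.
  by rewrite -(fineK IH) -EFinM ltry.
rewrite ge0_fin_numE ?mean_sqdist_ge0//.
apply: (@le_lt_trans _ _ (mean_sqdist n.+1 (cst xs) + (2 * c n)%:E * mean_gap n)%E).
  by rewrite leeDl// mule_ge0 ?mean_gap_ge0// lee_fin mulr_ge0.
apply: le_lt_trans (mean_sqdist_step_min n) _.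
by rewrite -(fineK IH) -(fineK gfin) -!EFinM -!EFinD ltry.
Qed.

Lemma mean_gap_fin n : mean_gap n \is a fin_num.
Proof.
rewrite ge0_fin_numE ?mean_gap_ge0// (le_lt_trans (mean_gap_le_sqdist n))//.
by rewrite -(fineK (mean_sqdist_min_fin n)) -EFinM ltry.
Qed.

Lemma mean_sqdist_iterate_fin m n : (m <= n)%N -> mean_sqdist n (X m) \is a fin_num.
Proof.
elim: n => [|n IH]; rewrite leq_eqVlt => /predU1P[->|//].
- rewrite /mean_sqdist; under eq_integral do rewrite subrr dotp0.
  by rewrite integral0.
- rewrite /mean_sqdist; under eq_integral do rewrite subrr dotp0.
  by rewrite integral0.
rewrite ltnS => mn.
rewrite ge0_fin_numE ?mean_sqdist_ge0//.
apply: (@le_lt_trans _ _ (mean_sqdist n.+1 (X m) + (2 * c n)%:E * mean_gap n)%E).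
  by rewrite leeDl// mule_ge0 ?mean_gap_ge0// lee_fin mulr_ge0.
apply: le_lt_trans (mean_sqdist_step (iterate_past mn)) _.
rewrite -/(mean_gap m) -(fineK (IH mn)) -(fineK (mean_gap_fin n)) -(fineK (mean_gap_fin m)).
by rewrite -!EFinM -!EFinD ltry.
Qed.

(** The real-valued form of [mean_sqdist_step], for Y = xs (sequence D) and for
    Y = X m (sequence E, which starts from 0 at time m). *)
Lemma sgd_recursions : exists a D : nat -> R,
  [/\ forall n, has_integral P (fun w => phi (X n w)) (a n),
      forall n, 0 <= a n,
      forall n, 0 <= D n,
      forall n, D n.+1 + 2 * c n * a n <= D n + c n ^+ 2 * (A * a n + B) &
      forall m, exists E : nat -> R, [/\ forall n, 0 <= E n, E m = 0 &
        forall n, (m <= n)%N ->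
          E n.+1 + 2 * c n * a n <=
          E n + 2 * c n * a m + c n ^+ 2 * (A * a n + B)]].
Proof.
pose a n := fine (mean_gap n).
have aE n : mean_gap n = (a n)%:E by rewrite fineK// mean_gap_fin.
have a0 n : 0 <= a n by apply: fine_ge0; exact: mean_gap_ge0.
exists a, (fun n => fine (mean_sqdist n (cst xs))); split => //.
- move=> n; have mphiX : measurable_fun [set: Omega] (fun w => phi (X n w)).
    exact: (measurableT_comp mphi (iterate_measurable n)).
  have := @ge0_has_integral _ _ _ P _ (a n) mphiX (fun w => phi0 _).
  rewrite -[X in (X <= _)%E]/(mean_gap n) aE lexx => /(_ isT)[w iw _].
  suff <- : w = a n by [].
  by apply: EFin_inj; rewrite -aE /mean_gap; have [_ <-] := iw.
- by move=> n; apply: fine_ge0; exact: mean_sqdist_ge0.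
- move=> n; have := mean_sqdist_step_min n.
  rewrite -(fineK (mean_sqdist_min_fin n)) -(fineK (mean_sqdist_min_fin n.+1)) aE.
  by rewrite -!EFinM -!EFinD lee_fin.
- move=> m; exists (fun n => fine (mean_sqdist n (X m))); split.
  + by move=> n; apply: fine_ge0; exact: mean_sqdist_ge0.
  + rewrite /mean_sqdist; under eq_integral do rewrite subrr dotp0.
    by rewrite integral0.
  + move=> n mn; have := mean_sqdist_step (iterate_past mn).
    rewrite -/(mean_gap m) -(fineK (mean_sqdist_iterate_fin mn)).
    rewrite -(fineK (mean_sqdist_iterate_fin (leqW mn))) !aE.
    by rewrite -!EFinM -!EFinD lee_fin.
Qed.

End sgd.

(** * From the recursions to a rate for the last iterate *)

Section last_iterate.
Context (R : realType).

(** One step of the Shamir-Zhang argument: T / W is the weighted average of the last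
    k + 1 values, and b is the value that precedes them, with weight u.  If b is
    at least the longer average S, then dropping b does not increase the average.
    Otherwise the hypothesis bounds S - b by (A S + B) 4 s, and dropping b
    increases the average by u (S - b) / W, where u / W <= 4 / (k + 1). *)
Lemma suffix_average_step (A B s T W u b : R) (k : nat) :
  0 <= A -> 0 <= B -> 0 < s -> 0 <= T -> 0 <= b -> k.+1%:R * s <= W -> s <= u <= 4 * s ->
  T + u * b <= b * (W + u) + (A * b + B) * (4 * s ^+ 2 * k.+2%:R) ->
  T / W <= (1 + A * (16 * s / k.+1%:R)) * ((T + u * b) / (W + u)) +
    B * (16 * s / k.+1%:R).
Proof.
move=> A0 B0 s0 T0 b0 sW /andP[su u4s] hT.
set r := 16 * s / k.+1%:R; set S := (T + u * b) / (W + u).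
have k0 : 0 < k.+1%:R :> R by rewrite ltr0n.
have W0 : 0 < W by apply: lt_le_trans sW; rewrite mulr_gt0.
have Wu0 : 0 < W + u by lra.
have u0 : 0 < u by lra.
have SE : S * (W + u) = T + u * b by rewrite divfK// gt_eqF.
have rE : r * k.+1%:R = 16 * s by rewrite divfK// gt_eqF.
have r0 : 0 < r by rewrite divr_gt0// mulr_gt0.
rewrite ler_pdivrMr//.
suff : u * (S - b) <= r * (A * S + B) * W by nra.
have [bS|Sb] := leP S b.
  have S0 : 0 <= S by rewrite divr_ge0 ?(ltW Wu0)// addr_ge0// mulr_ge0// ltW.
  apply: (@le_trans _ _ 0).
    by rewrite mulr_ge0_le0 ?subr_le0// ltW.
  by rewrite mulr_ge0 ?(ltW W0)// mulr_ge0 ?(ltW r0)// addr_ge0// mulr_ge0.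
have ABS : A * b + B <= A * S + B by rewrite lerD2r ler_wpM2l// ltW.
have AB0 : 0 <= A * b + B by rewrite addr_ge0 ?mulr_ge0.
have h1 : (S - b) * (W + u) <= (A * S + B) * (4 * s) * (W + u).
  apply: (@le_trans _ _ ((A * b + B) * (4 * s ^+ 2 * k.+2%:R))).
    by rewrite mulrBl SE; lra.
  have sk : s * k.+2%:R <= W + u.
    by rewrite mulrC -natr1 mulrDl mul1r lerD.
  have sk4 : 4 * s ^+ 2 * k.+2%:R <= 4 * s * (W + u).
    have -> : 4 * s ^+ 2 * k.+2%:R = 4 * s * (s * k.+2%:R) by ring.
    by rewrite ler_pM2l ?mulr_gt0.
  rewrite -(mulrA (A * S + B)); apply: ler_pM => //.
  by rewrite mulr_ge0 ?ler0n// mulr_ge0// sqr_ge0.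
have {}h1 : S - b <= (A * S + B) * (4 * s) by rewrite -(ler_pM2r Wu0).
have rW : 16 * s ^+ 2 <= r * W.
  have : r * (k.+1%:R * s) <= r * W by rewrite ler_pM2l.
  by rewrite mulrA rE expr2 mulrA.
apply: (@le_trans _ _ (4 * s * ((A * S + B) * (4 * s)))).
  by apply: ler_pM => //; [exact: ltW|rewrite subr_ge0 ltW].
have -> : 4 * s * ((A * S + B) * (4 * s)) = (A * S + B) * (16 * s ^+ 2) by ring.
rewrite (mulrC r) -mulrA ler_wpM2l//; lra.
Qed.

(** The index counts backwards from the last iterate: b 0 is the quantity of
    interest, and T k / W k is the weighted average of b 0, ..., b k.  The relative
    errors of [suffix_average_step] multiply up to at most expR (A * h K), as
    1 + x <= expR x. *)
Lemma suffix_average (A B s : R) (b u : nat -> R) (K : nat)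
    (T := fun k => \sum_(i < k.+1) u i * b i) (W := fun k => \sum_(i < k.+1) u i)
    (h := fun k => 16 * s * \sum_(j < k) j.+1%:R^-1) :
  0 <= A -> 0 <= B -> 0 < s -> (forall i, 0 <= b i) ->
  (forall i, (i <= K)%N -> s <= u i <= 4 * s) ->
  (forall k, (k <= K)%N ->
    T k <= b k * W k + (A * b k + B) * (4 * s ^+ 2 * k.+1%:R)) ->
  b 0%N <= expR (A * h K) * (T K / W K + B * h K).
Proof.
move=> A0 B0 s0 b0 hu hT.
have WS k : W k.+1 = W k + u k.+1 by rewrite /W big_ord_recr.
have TS k : T k.+1 = T k + u k.+1 * b k.+1 by rewrite /T big_ord_recr.
have hS k : h k.+1 = h k + 16 * s / k.+1%:R.
  by rewrite /h big_ord_recr mulrDr.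
have h0 k : 0 <= h k.
  by rewrite /h !mulr_ge0 ?sumr_ge0 ?ltW// => j _; rewrite invr_ge0.
have sW k : (k <= K)%N -> k.+1%:R * s <= W k.
  elim: k => [|k IH] kK.
    by rewrite /W big_ord1 mul1r; have /andP[] := hu 0%N kK.
  rewrite WS -natr1 mulrDl mul1r lerD ?IH 1?ltnW//.
  by have /andP[] := hu _ kK.
have W0 k : (k <= K)%N -> 0 < W k.
  by move=> /sW; apply: lt_le_trans; rewrite mulr_gt0.
have T0 k : (k <= K)%N -> 0 <= T k.
  move=> kK; apply: sumr_ge0 => i _; rewrite mulr_ge0//.
  have /andP[+ _] := hu i (leq_trans (ltn_ord i : (i <= k)%N) kK).
  by apply: le_trans; exact: ltW.
suff : forall k, (k <= K)%N -> b 0%N <= expR (A * h k) * (T k / W k + B * h k).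
  by apply.
elim=> [_|k IH kK].
  rewrite /h big_ord0 !mulr0 expR0 mul1r addr0 /T /W !big_ord1 [u _ * _]mulrC mulfK//.
  by rewrite gt_eqF//; have /andP[+ _] := hu 0%N (leq0n _); exact: lt_le_trans.
apply: le_trans (IH (ltnW kK)) _.
have := @suffix_average_step A B s (T k) (W k) (u k.+1) (b k.+1) k A0 B0 s0 (T0 _ (ltnW kK)) (b0 _)
  (sW _ (ltnW kK)) (hu _ kK).
rewrite -TS -WS => /(_ (hT _ kK)).
set r := 16 * s / _ => step.
have r0 : 0 <= r by rewrite !mulr_ge0 ?invr_ge0 ?ltW.
have S0 : 0 <= T k.+1 / W k.+1 by rewrite divr_ge0 ?T0// ltW ?W0.
apply: (@le_trans _ _ (expR (A * h k) *
    ((1 + A * r) * (T k.+1 / W k.+1 + B * h k.+1)))).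
  rewrite ler_wpM2l ?expR_ge0// hS -/r.
  have := h0 k; have : 0 <= A * r by rewrite mulr_ge0.
  move=> Ar0 hk0.
  have : 0 <= A * r * (B * (h k + r)).
    by apply: mulr_ge0 => //; apply: mulr_ge0 => //; exact: addr_ge0.
  lra.
rewrite hS -/r (mulrDr A) expRD -mulrA ler_wpM2l ?expR_ge0//.
rewrite ler_wpM2r ?expR_ge1Dx// addr_ge0// mulr_ge0// addr_ge0//.
Qed.

(** Induction, with ln (k + 2) - ln (k + 1) >= 1 / (k + 2), which is ln x <= x - 1 at
    x = (k + 1) / (k + 2). *)
Lemma harmonic_le_ln k : \sum_(j < k.+1) j.+1%:R^-1 <= 1 + ln k.+1%:R :> R.
Proof.
elim: k => [|k IH]; first by rewrite big_ord1 invr1 ln1 addr0.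
rewrite big_ord_recr/=.
have k1 : 0 < k.+1%:R :> R by rewrite ltr0n.
have k2 : 0 < k.+2%:R :> R by rewrite ltr0n.
have : ln (k.+1%:R / k.+2%:R : R) <= k.+1%:R / k.+2%:R - 1.
  have := @le_ln1Dx R (k.+1%:R / k.+2%:R - 1).
  rewrite addrCA subrr addr0; apply.
  by have := divr_gt0 k1 k2; move: (_ / _) => q; lra.
rewrite ln_div ?posrE// => hl.
have -> : k.+2%:R^-1 = 1 - k.+1%:R / k.+2%:R :> R.
  apply: (mulIf (lt0r_neq0 k2)).
  by rewrite mulrBl divfK ?mulVf ?lt0r_neq0// mul1r -[k.+2%:R]natr1 addrAC subrr add0r.
move: (_ / _) (ln _) (ln _) (\sum_(_ < _) _) hl IH => q l1 l2 S hl IH; lra.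
Qed.

(** ln y <= y - 1 at y = x `^ alpha. *)
Lemma ln_le_powR (x alpha : R) : 0 < x -> 0 < alpha -> ln x <= x `^ alpha / alpha.
Proof.
move=> x0 a0; rewrite ler_pdivlMr// mulrC -ln_powR.
have := @le_ln1Dx R (x `^ alpha - 1).
rewrite addrCA subrr addr0 => h; have := h _.
have xp : 0 < x `^ alpha by rewrite powR_gt0.
by lra.
Qed.

Lemma telescope_rev (x E : nat -> R) (N k : nat) : (k <= N)%N ->
  (forall n, (N - k <= n)%N -> x n <= E n - E n.+1) ->
  \sum_(i < k.+1) x (N - i)%N <= E (N - k)%N - E N.+1.
Proof.
elim: k => [|k IH] kN hx; first by rewrite big_ord1 subn0 hx// subn0.
rewrite big_ord_recr/=.
have := IH (ltnW kN) _.
have -> : (N - k = (N - k.+1).+1)%N by rewrite -subSn// subSS.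
move=> /(_ _)-h; have := hx (N - k.+1)%N (leqnn _).
have : \sum_(i < k.+1) x (N - i)%N <= E (N - k.+1).+1 - E N.+1.
  by apply: h => n hn; apply: hx; apply: leq_trans hn.
lra.
Qed.

(** Write n^(- 2 alpha) as n^(1 - 2 alpha) / n and bound the first factor by its
    largest value, at n = N + 1 or n = 1 according to the sign of the
    exponent, before summing 1 / n. *)
Lemma sum_sqr_steps_le (gamma alpha : R) (N : nat) (M : R := N.+1%:R)
    (q := Num.max (1 - 2 * alpha) 0) : 0 < gamma ->
  \sum_(n < N.+1) (gamma * n.+1%:R `^ (- alpha)) ^+ 2 <=
    gamma ^+ 2 * (M `^ q * (1 + ln M)).
Proof.
move=> g0.
apply: (@le_trans _ _ (\sum_(n < N.+1) gamma ^+ 2 * (M `^ q * n.+1%:R^-1))).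
  apply: ler_sum => n _; rewrite exprMn ler_wpM2l ?sqr_ge0//.
  have n0 : 0 < n.+1%:R :> R by rewrite ltr0n.
  have nn0 : n.+1%:R != 0 :> R by rewrite gt_eqF.
  rewrite -powR_mulrn ?powR_ge0// -powRrM.
  have -> : - alpha * 2%:R = (1 - 2 * alpha) + -1 by ring.
  rewrite powRD ?nn0 ?implybT// powR_inv1// ler_wpM2r ?invr_ge0//.
  apply: (@le_trans _ _ (n.+1%:R `^ q)).
    by rewrite ler_powR ?ler1n// le_max lexx.
  by rewrite ge0_ler_powR ?nnegrE ?ler0n ?le_max ?lexx ?orbT// ler_nat ltn_ord.
rewrite -mulr_sumr -mulr_sumr ler_wpM2l ?sqr_ge0// ler_wpM2l ?powR_ge0//.
exact: harmonic_le_ln.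
Qed.

Lemma step_eventually_small (gamma alpha A : R) :
  0 < gamma -> 0 < alpha -> 0 <= A ->
  exists n0, forall n, (n0 <= n)%N -> A * (gamma * n.+1%:R `^ (- alpha)) <= 1.
Proof.
move=> g0 a0 A0.
exists (Num.truncn ((A * gamma) `^ alpha^-1)) => n hn.
rewrite mulrA powRN ler_pdivrMr ?powR_gt0 ?ltr0n// mul1r.
have : (A * gamma) `^ alpha^-1 <= n.+1%:R.
  by rewrite (le_trans (ltW (truncnS_gt _)))// ler_nat.
move=> /(ge0_ler_powR (ltW a0)).
rewrite !nnegrE powR_ge0 ler0n => /(_ isT isT).
by rewrite -powRrM mulVf ?gt_eqF// powRr1// mulr_ge0// ltW.
Qed.

Section rate.
Variables (gamma alpha A B : R) (a D : nat -> R).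
Hypotheses (gamma0 : 0 < gamma) (alpha01 : 0 < alpha < 1).
Hypotheses (A0 : 0 <= A) (B0 : 0 <= B).
Hypotheses (a0 : forall n, 0 <= a n) (D0 : forall n, 0 <= D n).

Let c n : R := gamma * n.+1%:R `^ (- alpha).

Hypothesis D_rec : forall n,
  D n.+1 + 2 * c n * a n <= D n + c n ^+ 2 * (A * a n + B).
Hypothesis E_rec : forall m, exists E : nat -> R,
  [/\ forall n, 0 <= E n, E m = 0 & forall n, (m <= n)%N ->
    E n.+1 + 2 * c n * a n <= E n + 2 * c n * a m + c n ^+ 2 * (A * a n + B)].

(* the weight that a_n keeps once the term A * c n ^+ 2 * a n is absorbed *)
Let w n := 2 * c n - A * c n ^+ 2.

Lemma step_gt0 n : 0 < c n.
Proof. by rewrite mulr_gt0// powR_gt0 ltr0n. Qed.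

(** The factor 2 bounds 2^alpha, as alpha < 1. *)
Lemma step_half N n : (n <= N)%N -> (N <= n.*2.+1)%N -> c N <= c n <= 2 * c N.
Proof.
move=> nN Nn; have /andP[al0 al1] := alpha01.
have n0 : 0 < n.+1%:R :> R by rewrite ltr0n.
have N0 : 0 < N.+1%:R :> R by rewrite ltr0n.
apply/andP; split.
  rewrite ler_pM2l// !powRN lef_pV2 ?posrE ?powR_gt0//.
  by rewrite ge0_ler_powR ?(ltW al0) ?nnegrE// ler_nat.
rewrite mulrCA ler_pM2l// !powRN ler_pdivlMr ?powR_gt0//.
rewrite mulrC ler_pdivrMr ?powR_gt0//.
apply: (@le_trans _ _ ((2 * n.+1%:R) `^ alpha)).
  rewrite ge0_ler_powR ?(ltW al0) ?nnegrE ?mulr_ge0// -natrM ler_nat.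
  by rewrite mul2n doubleS ltnS.
rewrite powRM// ler_wpM2r ?powR_ge0//.
by rewrite -[leRHS](@powRr1 R 2) ?ler_powR ?ler1n// ltW.
Qed.

(** The recursions, summed over the last K + 1 steps, are the hypotheses of
    [suffix_average] for s = c N: once A c_n <= 1, the weights w n lie between
    c n and 2 c n, hence between s and 4 s.  The average of the last K + 1 gaps is
    then bounded by summing the recursion of D from time n0. *)
Lemma last_iterate_window (n0 N : nat) (K := N./2) (s := c N)
    (h := 16 * s * \sum_(j < K) j.+1%:R^-1) :
  (forall n, (n0 <= n)%N -> A * c n <= 1) -> (n0.*2 <= N)%N ->
  a N <= expR (A * h) *
    ((D n0 + B * \sum_(n < N.+1) c n ^+ 2) / (K.+1%:R * s) + B * h).
Proof.
move=> small n0N.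
have s0 : 0 < s := step_gt0 N.
have KN : (K <= N)%N by rewrite /K; lia.
have n0K : (n0 <= N - K)%N by rewrite leq_subRL// /K; lia.
have Kn0 : (K <= N - n0)%N by rewrite leq_subRL; lia.
have window i : (i <= K)%N -> c N <= c (N - i)%N <= 2 * c N.
  by move=> iK; apply: step_half; [exact: leq_subr|rewrite /K in iK; lia].
have wE n : w n = c n * (2 - A * c n) by rewrite /w; ring.
have w_ge n : (n0 <= n)%N -> c n <= w n.
  move=> /small h1; rewrite wE -[leLHS]mulr1 ler_pM2l ?step_gt0//; lra.
have w_le n : w n <= 2 * c n.
  by rewrite /w lerBlDr lerDl mulr_ge0// sqr_ge0.
have hw i : (i <= K)%N -> s <= w (N - i)%N <= 4 * s.
  move=> iK; have /andP[w1 w2] := window i iK.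
  have := w_ge (N - i)%N (leq_trans n0K (leq_sub2l N iK)).
  have := w_le (N - i)%N; rewrite /s; lra.
have hT k : (k <= K)%N ->
    \sum_(i < k.+1) w (N - i)%N * a (N - i)%N <=
    a (N - k)%N * (\sum_(i < k.+1) w (N - i)%N) +
    (A * a (N - k)%N + B) * (4 * s ^+ 2 * k.+1%:R).
  move=> kK; set m := (N - k)%N.
  have [E [E0 Em Erec]] := E_rec m.
  have kN := leq_trans kK KN.
  have := @telescope_rev
    (fun n => w n * a n - (a m * w n + (A * a m + B) * c n ^+ 2)) E N k kN.
  rewrite -/m Em => tele.
  have {tele} : \sum_(i < k.+1) (w (N - i)%N * a (N - i)%N -
      (a m * w (N - i)%N + (A * a m + B) * c (N - i)%N ^+ 2)) <= 0 - E N.+1.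
    apply: tele => n mn; have := Erec n mn; rewrite /w; lra.
  rewrite sumrB big_split/= -!mulr_sumr sub0r => tele.
  have c4 : \sum_(i < k.+1) c (N - i)%N ^+ 2 <= 4 * s ^+ 2 * k.+1%:R.
    have -> : 4 * s ^+ 2 * k.+1%:R = \sum_(i < k.+1) 4 * s ^+ 2.
      by rewrite sumr_const card_ord mulr_natr.
    apply: ler_sum => i _.
    have /andP[c1 c2] := window i (leq_trans (ltn_ord i : (i <= k)%N) kK).
    have -> : 4 * s ^+ 2 = (2 * c N) ^+ 2 by rewrite /s; ring.
    have ci0 : 0 <= c (N - i)%N by exact/ltW/step_gt0.
    have cN0 : 0 <= 2 * c N by apply: mulr_ge0 => //; exact: ltW.
    by rewrite ler_pXn2r.
  have : (A * a m + B) * \sum_(i < k.+1) c (N - i)%N ^+ 2 <=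
         (A * a m + B) * (4 * s ^+ 2 * k.+1%:R).
    by rewrite ler_wpM2l// addr_ge0// mulr_ge0.
  have := E0 N.+1; lra.
have := @suffix_average A B s (fun i => a (N - i)%N) (fun i => w (N - i)%N) K
  A0 B0 s0 (fun i => a0 _) hw hT.
rewrite subn0 -/h => /le_trans; apply.
rewrite ler_wpM2l ?expR_ge0// lerD2r.
have sW : K.+1%:R * s <= \sum_(i < K.+1) w (N - i)%N.
  have -> : K.+1%:R * s = \sum_(i < K.+1) s.
    by rewrite sumr_const card_ord mulr_natl.
  by apply: ler_sum => i _; have /andP[] := hw i (ltn_ord i : (i <= K)%N).
have sK0 : 0 < K.+1%:R * s by rewrite mulr_gt0.
have wa0 i : (i <= N - n0)%N -> 0 <= w (N - i)%N * a (N - i)%N.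
  move=> iN; rewrite mulr_ge0//; apply: le_trans (ltW (step_gt0 _)) (w_ge _ _).
  by lia.
apply: ler_pM.
- apply: sumr_ge0 => i _; apply: wa0.
  by rewrite (leq_trans _ Kn0)// -ltnS.
- by rewrite invr_ge0 (le_trans (ltW sK0)).
- have := @telescope_rev (fun n => w n * a n - B * c n ^+ 2) D N (N - n0)%N
    (leq_subr _ _).
  rewrite subKn; last by rewrite (leq_trans n0K) ?leq_subr.
  move=> /(_ _)-tele.
  have {tele} : \sum_(i < (N - n0).+1) (w (N - i)%N * a (N - i)%N -
      B * c (N - i)%N ^+ 2) <= D n0 - D N.+1.
    by apply: tele => n _; have := D_rec n; rewrite /w; lra.
  rewrite sumrB -mulr_sumr => tele.
  have mono (F : nat -> R) (p r : nat) : (p <= r)%N ->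
      (forall i, (i < r)%N -> 0 <= F i) ->
      \sum_(i < p) F i <= \sum_(i < r) F i.
    move=> pr F0; rewrite -(subnKC pr) big_split_ord/= lerDl sumr_ge0// => i _.
    by apply: F0; rewrite -{2}(subnKC pr) ltn_add2l.
  have t1 : \sum_(i < K.+1) w (N - i)%N * a (N - i)%N <=
      \sum_(i < (N - n0).+1) w (N - i)%N * a (N - i)%N.
    apply: (mono (fun i => w (N - i)%N * a (N - i)%N)) => //.
  have t2 : \sum_(i < (N - n0).+1) c (N - i)%N ^+ 2 <= \sum_(n < N.+1) c n ^+ 2.
    rewrite [leRHS](reindex_inj rev_ord_inj)/=.
    apply: (mono (fun i => c (N.+1 - i.+1)%N ^+ 2)); first by rewrite ltnS leq_subr.
    by move=> i _; exact: sqr_ge0.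
  have t3 : B * \sum_(i < (N - n0).+1) c (N - i)%N ^+ 2 <=
      B * \sum_(n < N.+1) c n ^+ 2 by rewrite ler_wpM2l.
  have := D0 N.+1; lra.
- by rewrite lef_pV2 ?posrE// (lt_le_trans sK0).
Qed.

End rate.

End last_iterate.

Lemma half_le n : (n./2 <= n)%N.
Proof. by lia. Qed.

Lemma half_window_ge n : (n.+1 <= n./2.+1 * 2)%N.
Proof. by lia. Qed.

(** [last_iterate_window] applies from time 2 n0 on, where A c_n <= 1 for n >= n0:
    the last half of the iterates then starts after n0.  The finitely many earlier
    gaps are absorbed in the constant. *)
Lemma last_iterate_rate (R : realType) (gamma alpha A B : R) (a D : nat -> R)
    (c := fun n : nat => gamma * n.+1%:R `^ (- alpha)) :
  0 < gamma -> 0 < alpha < 1 -> 0 <= A -> 0 <= B ->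
  (forall n, 0 <= a n) -> (forall n, 0 <= D n) ->
  (forall n, D n.+1 + 2 * c n * a n <= D n + c n ^+ 2 * (A * a n + B)) ->
  (forall m, exists E : nat -> R,
    [/\ forall n, 0 <= E n, E m = 0 & forall n, (m <= n)%N ->
    E n.+1 + 2 * c n * a n <= E n + 2 * c n * a m + c n ^+ 2 * (A * a n + B)]) ->
  exists2 C, 0 <= C & forall N, a N <=
    C * ((1 + ln N.+1%:R) ^+ 2 / N.+1%:R `^ (Num.min alpha (1 - alpha))).
Proof.
move=> g0 al01 A0 B0 a0 D0 D_rec E_rec; have /andP[al0 al1] := al01.
set mu := Num.min alpha (1 - alpha).
pose ell N : R := 1 + ln N.+1%:R.
pose M N : R := N.+1%:R.
pose beta N : R := ell N ^+ 2 / M N `^ mu.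
have M1 N : 1 <= M N by rewrite /M ler1n.
have M0 N : 0 < M N by rewrite /M ltr0n.
have ell1 N : 1 <= ell N by rewrite /ell lerDl ln_ge0// M1.
have beta0 N : 0 < beta N.
  by rewrite divr_gt0 ?powR_gt0// exprn_gt0// (lt_le_trans _ (ell1 N)).
have [n0 small] := step_eventually_small g0 al0 A0.
(* kappa bounds A * h because c N * ell N does not grow with N *)
pose kappa := A * (16 * (gamma * (1 + alpha^-1))).
pose C1 := 2 / gamma * (D n0 + B * gamma ^+ 2).
pose C := expR kappa * (C1 + B * (16 * gamma)).
have C10 : 0 <= C1.
  apply: mulr_ge0; first by rewrite divr_ge0// ltW.
  by rewrite addr_ge0// mulr_ge0// sqr_ge0.
have C0 : 0 <= C.
  apply: mulr_ge0; first exact: expR_ge0.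
  by rewrite addr_ge0// mulr_ge0// mulr_ge0// ltW.
pose C2 := \sum_(n < n0.*2) a n / beta n.
have C20 : 0 <= C2 by apply: sumr_ge0 => n _; rewrite divr_ge0// ltW.
exists (C + C2); first exact: addr_ge0.
move=> N; rewrite -/(ell N) -/(M N) -/(beta N) mulrDl.
have [Nn0|n0N] := ltnP N n0.*2.
  have : a N / beta N <= C2.
    rewrite /C2 (bigD1 (Ordinal Nn0))//= lerDl sumr_ge0// => n _.
    by rewrite divr_ge0// ltW.
  rewrite ler_pdivrMr// => /le_trans; apply.
  by rewrite lerDr mulr_ge0// ltW.
apply: (@le_trans _ _ (C * beta N)); last by rewrite lerDl mulr_ge0// ltW.
have := last_iterate_window g0 al01 A0 B0 a0 D0 D_rec E_rec small n0N.
rewrite -/(c N); set K := N./2; set h := 16 * c N * _ => /le_trans; apply.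
have c0 n : 0 < c n by rewrite mulr_gt0// powR_gt0// ltr0n.
have Hell : \sum_(j < K) j.+1%:R^-1 <= ell N.
  apply: le_trans (harmonic_le_ln R N).
  have KN : (K <= N.+1)%N by exact: leqW (half_le N).
  rewrite -(subnKC KN) big_split_ord/= lerDl; apply: sumr_ge0 => i _.
  by rewrite invr_ge0 ler0n.
have h1 : h <= 16 * c N * ell N by rewrite ler_pM2l// mulr_gt0.
have Mpow x y : x <= y -> M N `^ x <= M N `^ y by move=> xy; rewrite ler_powR.
have Mn0 : M N != 0 by rewrite gt_eqF.
have Mpow1 x : 0 <= x -> 1 <= M N `^ x.
  by move=> x0; rewrite -(powRr0 (M N)) Mpow.
have mu_al : mu <= alpha by rewrite ge_min lexx.
have h2 : h <= 16 * gamma * (ell N / M N `^ mu).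
  apply: le_trans h1 _.
  have -> : 16 * c N * ell N = 16 * gamma * (ell N / M N `^ alpha).
    by rewrite /c powRN -/(M N); ring.
  rewrite ler_pM2l ?mulr_gt0// ler_pM2l; last exact: lt_le_trans (ell1 N).
  by rewrite lef_pV2 ?posrE ?powR_gt0// Mpow.
have hk : A * h <= kappa.
  apply: ler_wpM2l => //; apply: le_trans h1 _.
  rewrite -mulrA ler_pM2l// /c -mulrA ler_pM2l// powRN mulrC.
  rewrite ler_pdivrMr ?powR_gt0// mulrDl mul1r /ell.
  rewrite lerD//; first exact/Mpow1/ltW.
  by rewrite mulrC; exact: ln_le_powR.
pose q : R := Num.max (1 - 2 * alpha) 0.
have S1 : D n0 + B * \sum_(n < N.+1) c n ^+ 2 <=
    (D n0 + B * gamma ^+ 2) * (M N `^ q * ell N).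
  have MqE : 1 <= M N `^ q * ell N.
    rewrite -[leLHS]mulr1 ler_pM// Mpow1//.
    by rewrite le_max lexx orbT.
  rewrite mulrDl lerD//; first by rewrite -[leLHS]mulr1 ler_wpM2l.
  by rewrite -mulrA ler_wpM2l//; exact: sum_sqr_steps_le.
have S2 : gamma / 2 * M N `^ (1 - alpha) <= K.+1%:R * c N.
  have -> : gamma / 2 * M N `^ (1 - alpha) = M N / 2 * c N.
    rewrite /c -/(M N) powRD ?Mn0 ?implybT//.
    by rewrite powRr1 ?(ltW (M0 N))//; ring.
  rewrite ler_pM2r// ler_pdivrMr//.
  by rewrite -(natrM R K.+1 2) /M ler_nat half_window_ge.
have mid : (D n0 + B * \sum_(n < N.+1) c n ^+ 2) / (K.+1%:R * c N) <=
    C1 * (ell N / M N `^ mu).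
  apply: (@le_trans _ _ ((D n0 + B * gamma ^+ 2) * (M N `^ q * ell N) /
      (gamma / 2 * M N `^ (1 - alpha)))).
    apply: ler_pM => //.
    - rewrite addr_ge0// mulr_ge0// sumr_ge0// => n _; exact: sqr_ge0.
    - by rewrite invr_ge0 mulr_ge0// ltW.
    - rewrite lef_pV2 ?posrE// ?mulr_gt0 ?divr_gt0 ?powR_gt0 ?ltr0n//.
  have Mmu : M N `^ q / M N `^ (1 - alpha) = (M N `^ mu)^-1.
    rewrite -!powRN -powRD ?Mn0 ?implybT//; congr (_ `^ _).
    rewrite /q /mu; have [] := leP alpha (1 - alpha);
      have [] := leP 0 (1 - 2 * alpha); lra.
  rewrite -Mmu /C1 le_eqVlt; apply/orP; left; apply/eqP.
  field.
  by rewrite !gt_eqF ?powR_gt0.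
have h0 : 0 <= h.
  apply: mulr_ge0; first by apply: mulr_ge0 => //; exact: ltW.
  by apply: sumr_ge0 => j _; rewrite invr_ge0 ler0n.
have num0 : 0 <= D n0 + B * \sum_(n < N.+1) c n ^+ 2.
  rewrite addr_ge0// mulr_ge0// sumr_ge0// => n _; exact: sqr_ge0.
apply: (@le_trans _ _ (C * (ell N / M N `^ mu))).
  rewrite /C -mulrA; apply: ler_pM.
  - exact: expR_ge0.
  - apply: addr_ge0; last by apply: mulr_ge0.
    by apply: divr_ge0 => //; apply: mulr_ge0 => //; exact: ltW.
  - by rewrite ler_expR.
  - by rewrite (mulrDl C1) lerD// -(mulrA B) ler_wpM2l.
rewrite ler_wpM2l// /beta ler_pM2r ?invr_gt0 ?powR_gt0//.
by rewrite expr2 ler_peMr// (le_trans ler01).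
Qed.

(** * The rate of stochastic gradient descent *)

Theorem theorem8 (R : realType) (d : nat) (f : 'rV[R]_d -> R)
  (f_C1 : C1 f)
  (L : R) (L_ge0 : 0 <= L) (f_lip : lipschitz_grad L f)
  (xstar : 'rV[R]_d) (xstar_min : forall x, f xstar <= f x)
  (Z : ptopologicalType) (Z_polish : polish R Z)
  (piZ : probability (borel Z) R)
  (eta : R) (eta_ge0 : 0 <= eta)
  (H : 'rV[R]_d -> Z -> 'rV[R]_d)
  (H_meas : @jointly_measurable R d Z _ (borel 'rV[R]_d) H)
  (H_cases :
    (unbiased_bounded_variance f piZ eta H /\ convex_fun f) \/
    (exists ft : 'rV[R]_d -> Z -> R,
      [/\ gradient_of_random_functions L f piZ eta ft,
          forall x z, H x z = grad (ft ^~ z) x &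
          forall z, convex_fun (ft ^~ z)]))
  (gamma alpha : R)
  (gamma01 : 0 < gamma < 1) (alpha01 : 0 < alpha < 1)
  (dO : measure_display) (Omega : measurableType dO) (P : probability Omega R)
  (Zn : nat -> {RV P >-> borel Z})
  (Zn_law : forall n (A : set (borel Z)), measurable A ->
    distribution P (Zn n) A = piZ A)
  (Zn_indep : mutually_independent P Zn)
  (x0 : 'rV[R]_d) (X : nat -> Omega -> 'rV[R]_d)
  (X_0 : forall w, X 0%N w = x0)
  (X_S : forall n w,
    X n.+1 w = X n w - (gamma * n.+1%:R `^ (- alpha)) *: H (X n w) (Zn n.+1 w)) :
  exists2 C : R, 0 <= C &
    forall N : nat, (1 <= N)%N ->
      ('E_P[fun w => f (X N w)] - (f xstar)%:E <=
        (C * ((1 + ln N.+1%:R) ^+ 2 /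
              N.+1%:R `^ (Num.min alpha (1 - alpha))))%:E)%E.
Proof.
have /andP[gamma0 _] := gamma01.
have g0 : grad f xstar = 0 by exact: grad_minimizer.
have [[A [B [A0 B0 Hsq]]] Hmean f_grad] :
  [/\ exists A B, [/\ 0 <= A, 0 <= B & forall x,
        second_moment_le (piZ : probability (borel Z) R) H x
          (A * (f x - f xstar) + B)],
      forall x, has_vintegral piZ (H x) (grad f x) &
      forall x u, f x - f u <= dotp (grad f x) (x - u)].
  have A0 : 0 <= 8 * (L + 1) by rewrite mulr_ge0// addr_ge0.
  case: H_cases => [[HH f_cvx]|[ft [[_ ft1 If Ig [xbar Hbar]] HE ft_cvx]]].
    split.
    - exists (8 * (L + 1)), (2 * eta); split => //; first by rewrite mulr_ge0.
      apply: (second_moment_variance L_ge0) => // x; by have [] := HH x.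
    - by move=> x; have [] := HH x.
    - move=> x u; have := convex_grad_le f_C1 f_cvx x u.
      by rewrite -(opprB x u) -scaleN1r dotpZr; lra.
  have {HE}-> : H = fun x z => grad (ft ^~ z) x by apply/funext => x; apply/funext.
  split => //.
  - have [B B0 HB] := @second_moment_random_functions _ (borel Z) R piZ d f L xstar
      ft xbar eta L_ge0 g0 ft1 ft_cvx If Ig Hbar.
    by exists (8 * (L + 1)), B.
  - move=> x u; rewrite -[- f u]mulN1r.
    apply: has_integral_le (has_integralD (If x) (has_integralZ (-1) (If u)))
      (has_integral_dotp (x - u) (Ig x)) _ => z.
    have [ftC1 _] := ft1 z; have := convex_grad_le ftC1 (ft_cvx z) x u.
    by rewrite -(opprB x u) -scaleN1r dotpZr; lra.
have mphi : measurable_fun [set: borel 'rV[R]_d] (fun x => f x - f xstar).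
  apply: measurable_funB => //; apply: continuous_borel_measurable => x.
  exact/differentiable_continuous/f_C1.1.
have phi0 x : 0 <= f x - f xstar by rewrite subr_ge0.
have phi_grad x u : (f x - f xstar) - (f u - f xstar) <= dotp (grad f x) (x - u).
  by have := f_grad x u; lra.
have phi_quad x : f x - f xstar <= (L + 1) * dotp (x - xstar) (x - xstar).
  apply: le_trans (f_grad x xstar) _.
  by have := dotp_grad_sub_le L_ge0 f_lip x xstar; rewrite g0 subr0.
have c0 n : 0 <= gamma * n.+1%:R `^ (- alpha).
  by rewrite mulr_ge0 ?powR_ge0// ltW.
have L10 : 0 <= L + 1 by rewrite addr_ge0.
have [a [D [aE a0 D0 D_rec E_rec]]] := sgd_recursions Zn_indep Zn_law H_meas X_0 X_S
  mphi phi0 phi_grad A0 B0 Hmean Hsq c0 (subrr _) L10 phi_quad.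
have [C C0 rate] := last_iterate_rate gamma0 alpha01 A0 B0 a0 D0 D_rec E_rec.
exists C => // N _; apply: le_trans (_ : (a N)%:E <= _)%E; last by rewrite lee_fin.
have [_] := has_integralD (aE N) (has_integral_cst P (f xstar)).
under eq_integral do rewrite subrK.
by rewrite unlock => ->; rewrite EFinD -EFinB lee_fin addrK.
Qed.
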